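(* Let $G=(V,E)$ be a finite connected simple graph with vertex set $V=\{a_1,\dots,a_N\}$, $N\ge 2$. Let $D$ be the maximal degree of $G$ and $\lambda_2$ the spectral gap of $G$. Let $\mu=(\mu_i)_{i=1}^N\in\mathcal{M}$, $m=\min\{\mu_i:1\le i\le N\}$ and $M=\max\{\mu_i:1\le i\le N\}$. Then for every $\nu=(\nu_i)_{i=1}^N\in\mathcal{M}$, $$d_m^2(\nu,\mu)\le K\,H(\nu\,|\,\mu),\qquad K=\frac{M(DN^3+4)}{2\lambda_2 m}\log\Big(\frac{18M}{m^3}\Big),$$ where $H(\nu|\mu)=\sum_{i=1}^N\nu_i\log\frac{\nu_i}{\mu_i}$ and $d_m$ is the lower bound metric on $\mathcal{M}$ (defined in the context; the subscript in $d_m$ is part of its name and unrelated to the number $m$).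
   Context: $\mathcal{M}=\{\rho=(\rho_i)_{i=1}^N\in\mathbb{R}^N:\ \sum_{i=1}^N\rho_i=1,\ \rho_i>0 \text{ for all } i\}$, with tangent space $T_\rho\mathcal{M}=\{\sigma\in\mathbb{R}^N:\sum_{i=1}^N\sigma_i=0\}$ at each $\rho\in\mathcal{M}$. The spectral gap $\lambda_2$ of $G$ is the second smallest eigenvalue of the (unnormalized) graph Laplacian, i.e. the diagonal matrix of vertex degrees minus the adjacency matrix. Lower bound metric $d_m$: for $\rho\in\mathcal{M}$ define the symmetric weight matrix $w^m(\rho)=(w^m_{ij}(\rho))_{i,j=1}^N$ by $w^m_{ij}(\rho)=\max\{\rho_i,\rho_j\}$ if $\{a_i,a_j\}\in E$ and $w^m_{ij}(\rho)=0$ otherwise. Let $\mathcal{L}(G,w^m(\rho))=\mathrm{diag}(\delta_1,\dots,\delta_N)-w^m(\rho)$, where $\delta_i$ is the $i$th row sum of $w^m(\rho)$. The map $p\mapsto p\,\mathcal{L}(G,w^m(\rho))$ (row vectors) induces a linear isomorphism from $\mathbb{R}^N/\mathbb{R}(1,\dots,1)$ onto $T_\rho\mathcal{M}$. Define the inner product on $T_\rho\mathcal{M}$ by $$g^m_\rho(\sigma^1,\sigma^2)=p^1\,\mathcal{L}(G,w^m(\rho))\,(p^2)^T,\quad\text{where } \sigma^k=p^k\mathcal{L}(G,w^m(\rho)),\ k=1,2.$$ The distance is $$d_m(\rho^1,\rho^2)=\inf_\gamma\int_0^1\sqrt{g^m_{\gamma(t)}(\dot\gamma(t),\dot\gamma(t))}\,dt,$$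 the infimum being over all continuously differentiable curves $\gamma:[0,1]\to\mathcal{M}$ with $\gamma(0)=\rho^1$, $\gamma(1)=\rho^2$. *)

(* Defs.v *)
From HB Require Import structures.
From mathcomp Require Import all_boot all_order all_algebra.
From mathcomp Require Import all_classical all_reals all_analysis.

Set Implicit Arguments.
Unset Strict Implicit.
Unset Printing Implicit Defensive.

Import Order.TTheory GRing.Theory Num.Theory.
Import numFieldNormedType.Exports.

Local Open Scope classical_set_scope.
Local Open Scope ring_scope.

Section Graph.
Variables (N : nat) (e : rel 'I_N).

Definition degree (i : 'I_N) : nat := #|[set j : 'I_N | e i j]%SET|.

Definition max_degree : nat := (\max_(i < N) degree i)%N.

Definition adjacency (R : realType) : 'M[R]_N := \matrix_(i, j) (e i j)%:R.

Definition graph_laplacian (R : realType) : 'M[R]_N :=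
  diag_mx (\row_i (degree i)%:R) - adjacency R.

End Graph.

(* The eigenvalues of A in nondecreasing order, repeated according to
   multiplicity. The list exists and is unique when the characteristic
   polynomial splits over R, in particular when A is symmetric; otherwise the
   value is [::]. *)
Definition eigenvalues (R : realType) (N : nat) (A : 'M[R]_N) : seq R :=
  xget [::] [set s : seq R | sorted <=%R s /\
                             char_poly A = \prod_(x <- s) ('X - x%:P)].

Definition spectral_gap (R : realType) (N : nat) (e : rel 'I_N) : R :=
  (eigenvalues (graph_laplacian e R))`_1.

Section Metric.
Variables (R : realType) (N : nat) (e : rel 'I_N).
Implicit Types (rho sigma p mu nu : 'rV[R]_N) (gamma : R -> 'rV[R]_N).

Definition prob_simplex : set 'rV[R]_N :=
  [set rho | \sum_i rho 0 i = 1 /\ forall i, 0 < rho 0 i].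

Definition weighted_laplacian (w : 'M[R]_N) : 'M[R]_N :=
  diag_mx (\row_i \sum_j w i j) - w.

Definition wm rho : 'M[R]_N :=
  \matrix_(i, j) (if e i j then Num.max (rho 0 i) (rho 0 j) else 0).

Definition Lm rho : 'M[R]_N := weighted_laplacian (wm rho).

(* [sigma *m pinvmx (Lm rho)] is one solution p of sigma = p *m Lm rho; a
   solution exists whenever rho is in [prob_simplex], the graph is connected
   and the entries of sigma sum to 0. By [gmE] the choice of p is irrelevant. *)
Definition gm rho sigma1 sigma2 : R :=
  let p sigma := sigma *m pinvmx (Lm rho) in
  (p sigma1 *m Lm rho *m (p sigma2)^T) 0 0.

Lemma gmE rho p1 p2 : symmetric e ->
  gm rho (p1 *m Lm rho) (p2 *m Lm rho) = (p1 *m Lm rho *m p2^T) 0 0.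
Proof.
move=> esym; have LT : (Lm rho)^T = Lm rho.
  rewrite /Lm /weighted_laplacian linearB /= tr_diag_mx; congr (_ - _).
  by apply/matrixP => i j; rewrite !mxE esym maxC.
have LtrM q : Lm rho *m q^T = (q *m Lm rho)^T by rewrite trmx_mul LT.
rewrite /gm /= mulmxKpV ?submxMl//; congr (fun_of_matrix _ 0 0).
by rewrite -[LHS]mulmxA -[RHS]mulmxA !LtrM mulmxKpV ?submxMl.
Qed.

(* Derivative relative to [0, 1]: two-sided inside, one-sided at 0 and 1. *)
Definition diff_quotient gamma (t s : R) : 'rV[R]_N :=
  (s - t)^-1 *: (gamma s - gamma t).

Definition velocity gamma (t : R) : 'rV[R]_N :=
  lim (diff_quotient gamma t s @[s --> within `[0, 1] (t^')]).

Definition C1_curve gamma : Prop :=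
  (forall t, 0 <= t <= 1 ->
     cvg (diff_quotient gamma t s @[s --> within `[0, 1] (t^')])) /\
  {within `[0, 1], continuous (velocity gamma)}.

Definition admissible_curve rho1 rho2 gamma : Prop :=
  [/\ C1_curve gamma, forall t, 0 <= t <= 1 -> prob_simplex (gamma t),
      gamma 0 = rho1 & gamma 1 = rho2].

Definition length_m gamma : \bar R :=
  (\int[@lebesgue_measure R]_(t in `[0%R, 1%R])
     (Num.sqrt (gm (gamma t) (velocity gamma t) (velocity gamma t)))%:E)%E.

(* The infimum is taken in \bar R, so no default value is involved. *)
Definition dm rho1 rho2 : \bar R :=
  ereal_inf [set length_m gamma | gamma in admissible_curve rho1 rho2].

Definition relative_entropy nu mu : R :=
  \sum_i nu 0 i * ln (nu 0 i / mu 0 i).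

(* The defaults 1 and 0 are neutral on [prob_simplex], whose points have all
   their entries between 0 and 1. *)
Definition min_entry mu : R := \big[Num.min/1]_i mu 0 i.

Definition max_entry mu : R := \big[Num.max/0]_i mu 0 i.

End Metric.

(* Main.v *)
(* The curve s |-> nu + s^2 (mu - nu) has velocity 2 s (mu - nu), and its
   entries are at least s^2 m, so that L(G, w^m) dominates s^2 m times the
   Laplacian of G along it. By the Poincare inequality with constant lambda_2
   its metric speed is thus at most 2 |mu - nu| / sqrt (m lambda_2), uniformly
   in s, which gives d_m^2 <= 4 |mu - nu|^2 / (m lambda_2). The entropy
   dominates the squared Hellinger distance, hence |mu - nu|_1^2 / 4, hence
   |mu - nu|_2^2 / 2 because mu - nu sums to zero. This yields
   d_m^2 <= 8 H / (m lambda_2), and 8 <= K m lambda_2 follows from M >= 1/N,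
   D >= 1 and m <= 1/N <= 1/2. *)
Require Import Defs.
From HB Require Import structures.
From mathcomp Require Import all_boot all_order all_algebra.
From mathcomp Require Import all_classical all_reals all_analysis.
From mathcomp Require Import complex spectral ring lra.

Set Implicit Arguments.
Unset Strict Implicit.
Unset Printing Implicit Defensive.

Import Order.TTheory GRing.Theory Num.Theory.
Import numFieldNormedType.Exports.

Local Open Scope classical_set_scope.
Local Open Scope ring_scope.

Local Notation toC := (@real_complex_def _ (Phant _)).

(** * Spectral theorem for real symmetric matrices *)

(** The intertwining relation passes to the characteristic matrices, and the determinant of [P], a
    nonzero constant polynomial, cancels. *)
Lemma char_poly_similar (F : fieldType) n (P A B : 'M[F]_n) :
  P \in unitmx -> P *m A = B *m P -> char_poly A = char_poly B.
Proof.
move=> Pu PA; pose Q := map_mx (@polyC F) P.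
have QA : Q *m char_poly_mx A = char_poly_mx B *m Q.
  rewrite /char_poly_mx mulmxBr mulmxBl -scalar_mxC; congr (_ - _).
  by rewrite -!map_mxM PA.
have detQ : \det Q != 0 by rewrite det_map_mx polyC_eq0 -unitfE -unitmxE.
by apply: (mulfI detQ); rewrite /char_poly -det_mulmx QA det_mulmx mulrC.
Qed.

Lemma char_poly_diag (F : comNzRingType) n (d : 'rV[F]_n) :
  char_poly (diag_mx d) = \prod_(i < n) ('X - (d 0 i)%:P).
Proof.
rewrite char_poly_trig; first by apply: eq_bigr => i _; rewrite mxE eqxx.
apply/is_trig_mxP => i j ij; rewrite mxE.
by case: eqP ij => // ->; rewrite ltnn.
Qed.

Section SymmetricDiagonalization.
Local Open Scope sesquilinear_scope.

(** A real symmetric matrix is Hermitian over [R[i]], so its spectral diagonal is real. The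
    eigenvalues [r] are taken back to [R], while the eigenvectors, the rows of [P], stay complex. *)
Lemma symmetric_unitary_diag (R : rcfType) n (A : 'M[R]_n) : A^T = A ->
  exists (P : 'M[(R[i])%C]_n) (r : 'rV[R]_n),
  [/\ P \is unitarymx,
      P *m map_mx toC A = diag_mx (map_mx toC r) *m P &
      char_poly A = \prod_(i < n) ('X - (r 0 i)%:P)].
Proof.
move=> Asym; set A' := map_mx toC A.
have herm : A' \is hermsymmx.
  apply: realsym_hermsym.
    by apply/is_hermitianmxP; rewrite expr0 scale1r map_mx_id //
      /A' map_trmx Asym.
  by apply/mxOverP => i j; rewrite mxE; apply/complex_realP; exists (A i j).
have /mxOverP dR := hermitian_spectral_diag_real herm.
pose P := spectralmx A'.
have Pu : P \is unitarymx by exact: spectral_unitarymx.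
pose r := map_mx (@complex.Re R) (spectral_diag A').
have rE : map_mx toC r = spectral_diag A'.
  by apply/matrixP => i j; rewrite !mxE RRe_real.
have PA : P *m A' = diag_mx (map_mx toC r) *m P.
  rewrite rE {1}(orthomx_spectralP (hermitian_normalmx herm)).
  by rewrite !mulmxA mulmxV ?mul1mx // spectral_unit.
exists P, r; split => //.
(* The embedding of real polynomials into complex ones is injective, so the identity may be checked
   over [R[i]], where [A] is similar to a diagonal matrix. *)
apply: (@map_poly_inj _ _ (toC : {rmorphism R -> (R[i])%C})).
rewrite map_char_poly (char_poly_similar (spectral_unit _) PA) char_poly_diag.
rewrite rmorph_prod; apply: eq_bigr => i _.
by rewrite rmorphB /= map_polyX map_polyC mxE.
Qed.

End SymmetricDiagonalization.

(** * Weighted graph Laplacians *)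

Section Laplacian.
Variables (R : realType) (n : nat).
Implicit Types (w : 'M[R]_n) (p q : 'rV[R]_n).

Lemma weighted_laplacianE w p j : w^T = w ->
  (p *m weighted_laplacian w) 0 j = \sum_i w j i * (p 0 j - p 0 i).
Proof.
move=> wT; rewrite /weighted_laplacian mulmxBr mul_mx_diag !mxE mulr_sumr.
rewrite -sumrB; apply: eq_bigr => i _.
by rewrite -{2}wT mxE mulrBr [p 0 j * _]mulrC [p 0 i * _]mulrC.
Qed.

Lemma weighted_laplacian_tr w : w^T = w ->
  (weighted_laplacian w)^T = weighted_laplacian w.
Proof. by move=> wT; rewrite /weighted_laplacian linearB /= tr_diag_mx wT. Qed.

Lemma dirichlet_form w p : w^T = w ->
  (p *m weighted_laplacian w *m p^T) 0 0 =
  2^-1 * \sum_i \sum_j w i j * (p 0 i - p 0 j) ^+ 2.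
Proof.
move=> wT; rewrite mxE.
under eq_bigr do rewrite weighted_laplacianE // mxE mulr_suml.
have wC i j : w j i = w i j by rewrite -{1}wT mxE.
(* Exchanging the summation indices gives a second form of [S]; adding the two forms completes the
   squares. *)
set S := LHS; have S2 : S = \sum_i \sum_j w i j * (p 0 j - p 0 i) * p 0 j.
  rewrite /S exchange_big /=; apply: eq_bigr => i _; apply: eq_bigr => j _.
  by rewrite wC.
suff -> : \sum_i \sum_j w i j * (p 0 i - p 0 j) ^+ 2 = S + S.
  by field.
rewrite {2}S2 /S -big_split; apply: eq_bigr => i _ /=.
rewrite -big_split; apply: eq_bigr => j _ /=.
by rewrite wC; ring.
Qed.

Lemma le_dirichlet_form w w' p : w^T = w -> w'^T = w' ->
  (forall i j, w i j <= w' i j) ->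
  (p *m weighted_laplacian w *m p^T) 0 0 <=
  (p *m weighted_laplacian w' *m p^T) 0 0.
Proof.
move=> wT wT' ww'; rewrite !dirichlet_form // ler_pM2l ?invr_gt0 //.
apply: ler_sum => i _; apply: ler_sum => j _.
by apply: ler_wpM2r; rewrite ?sqr_ge0.
Qed.

Lemma weighted_laplacianZ w a :
  weighted_laplacian (a *: w) = a *: weighted_laplacian w.
Proof.
rewrite /weighted_laplacian scalerBr; congr (_ - _).
apply/matrixP => i j; rewrite !mxE; under eq_bigr do rewrite mxE.
by rewrite -mulr_sumr mulrnAr.
Qed.

Variable e : rel 'I_n.
Hypothesis econn : forall i j : 'I_n, connect e i j.

(** Covers both the adjacency matrix and [wm e rho], so that kernel and image are studied once for
    both. *)
Definition weights_on w :=
  [/\ w^T = w, forall i j, 0 <= w i j & forall i j, e i j -> 0 < w i j].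

Lemma dirichlet_form_ge0 w p : weights_on w ->
  0 <= (p *m weighted_laplacian w *m p^T) 0 0.
Proof.
case=> wT w0 _; rewrite dirichlet_form //.
apply: mulr_ge0; first by rewrite invr_ge0.
by apply: sumr_ge0 => i _; apply: sumr_ge0 => j _; rewrite mulr_ge0 ?sqr_ge0.
Qed.

(** A kernel vector has zero Dirichlet energy, a sum of nonnegative terms, so it agrees at the two
    ends of every edge; connectedness propagates this along paths. *)
Lemma laplacian_kernel w p : weights_on w ->
  p *m weighted_laplacian w = 0 -> forall i j, p 0 i = p 0 j.
Proof.
case=> wT w0 we pL.
have adj i j : e i j -> p 0 i = p 0 j.
  move=> eij; have := @dirichlet_form w p wT.
  rewrite pL mul0mx mxE => /esym/eqP.
  rewrite mulf_eq0 invr_eq0 pnatr_eq0 /= => S0.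
  have pos k l : 0 <= w k l * (p 0 k - p 0 l) ^+ 2 by rewrite mulr_ge0 ?sqr_ge0.
  move: S0; rewrite psumr_eq0; last by move=> k _; apply: sumr_ge0.
  move=> /allP/(_ i (mem_index_enum _)) /=; rewrite psumr_eq0 //.
  move=> /allP/(_ j (mem_index_enum _)) /=.
  by rewrite mulf_eq0 gt_eqF ?we //= sqrf_eq0 subr_eq0 => /eqP.
move=> i j; have /connectP[s] := econn i j.
elim: s i => [|k s IH] i /=; first by move=> _ ->.
by move=> /andP[/adj -> ks] jE; apply: IH.
Qed.

(* The columns of the cokernel lie in the kernel, hence are constant. *)
Lemma laplacian_image w (s : 'rV[R]_n) : weights_on w ->
  \sum_i s 0 i = 0 -> (s <= weighted_laplacian w)%MS.
Proof.
move=> we s0; rewrite submxE; set C := cokermx _.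
have CL j : (col j C)^T *m weighted_laplacian w = 0.
  case: (we) => wT _ _; rewrite -{1}(weighted_laplacian_tr wT) -trmx_mul.
  by rewrite colE mulmxA mulmx_coker mul0mx trmx0.
apply/eqP/rowP => j; rewrite !mxE.
have Cc i : C i j = C j j.
  by have := laplacian_kernel we (CL j) i j; rewrite !mxE.
by under eq_bigr do rewrite Cc; rewrite -mulr_suml s0 mul0r.
Qed.

Lemma mulmx_const_laplacian w c : w^T = w ->
  (const_mx c : 'rV[R]_n) *m weighted_laplacian w = 0.
Proof.
move=> wT; apply/rowP => j; rewrite weighted_laplacianE // big1 ?mxE // => i _.
by rewrite !mxE subrr mulr0.
Qed.

End Laplacian.

(** * The spectral gap *)

Lemma Re_scale (R : rcfType) (z : (R[i])%C) (a : R) :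
  complex.Re (z * toC a) = complex.Re z * a.
Proof. by case: z => x y /=; rewrite mulr0 subr0. Qed.

Lemma Im_scale (R : rcfType) (z : (R[i])%C) (a : R) :
  complex.Im (z * toC a) = complex.Im z * a.
Proof. by case: z => x y /=; rewrite mulr0 add0r. Qed.

(** With its imaginary counterpart, this splits a complex eigenvector of a real matrix into two real
    ones for the same real eigenvalue. *)
Lemma map_Re_mulmx (R : rcfType) m n k (B : 'M[(R[i])%C]_(m, n))
    (A : 'M[R]_(n, k)) :
  map_mx (@complex.Re R) (B *m map_mx toC A) = map_mx (@complex.Re R) B *m A.
Proof.
apply/matrixP => i j; rewrite !mxE.
rewrite (raddf_sum (@complex.Re R : Rcomplex R -> R)).
by apply: eq_bigr => k' _; rewrite !mxE -Re_scale.
Qed.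

Lemma map_Im_mulmx (R : rcfType) m n k (B : 'M[(R[i])%C]_(m, n))
    (A : 'M[R]_(n, k)) :
  map_mx (@complex.Im R) (B *m map_mx toC A) = map_mx (@complex.Im R) B *m A.
Proof.
apply/matrixP => i j; rewrite !mxE.
rewrite (raddf_sum (@complex.Im R : Rcomplex R -> R)).
by apply: eq_bigr => k' _; rewrite !mxE -Im_scale.
Qed.

Lemma rVnormE (R : pzRingType) n (p : 'rV[R]_n) :
  (p *m p^T) 0 0 = \sum_i p 0 i ^+ 2.
Proof. by rewrite mxE; apply: eq_bigr => i _; rewrite mxE expr2. Qed.

Section SpectralGap.
Local Open Scope sesquilinear_scope.

Variables (R : realType) (n : nat) (e : rel 'I_n) (w : 'M[R]_n).
Hypothesis n2 : (2 <= n)%N.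
Hypothesis econn : forall i j : 'I_n, connect e i j.
Hypothesis we : weights_on e w.

Let A := weighted_laplacian w.
Let wT : w^T = w. Proof. by case: we. Qed.

(** * Rows of a unitary diagonalization as eigenvectors of the weighted Laplacian *)

Section Eigenbasis.
Variables (P : 'M[(R[i])%C]_n) (r : 'rV[R]_n).
Hypothesis Pu : P \is unitarymx.
Hypothesis PA : P *m map_mx toC A = diag_mx (map_mx toC r) *m P.

Lemma eigenrow k : row k P *m map_mx toC A = toC (r 0 k) *: row k P.
Proof. by rewrite -row_mul PA mul_diag_mx; apply/rowP => j; rewrite !mxE. Qed.

Lemma Re_eigenrow k :
  map_mx (@complex.Re R) (row k P) *m A =
  r 0 k *: map_mx (@complex.Re R) (row k P).
Proof.
rewrite -map_Re_mulmx eigenrow; apply/rowP => j.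
by rewrite !mxE mulrC Re_scale mulrC.
Qed.

Lemma Im_eigenrow k :
  map_mx (@complex.Im R) (row k P) *m A =
  r 0 k *: map_mx (@complex.Im R) (row k P).
Proof.
rewrite -map_Im_mulmx eigenrow; apply/rowP => j.
by rewrite !mxE mulrC Im_scale mulrC.
Qed.

Lemma eigenrow_neq0 k : row k P != 0.
Proof.
apply/eqP => Pk0; have /row_unitarymxP/(_ k k) := Pu.
by rewrite Pk0 linear0l eqxx => /esym/eqP; rewrite oner_eq0.
Qed.

(** The real or the imaginary part of the eigenrow is a nonzero real eigenvector, on which the
    Dirichlet form is nonnegative. *)
Lemma eigenvalue_ge0 k : 0 <= r 0 k.
Proof.
have pos (u : 'rV[R]_n) : u *m A = r 0 k *: u -> u != 0 -> 0 <= r 0 k.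
  move=> uA u0; have := dirichlet_form_ge0 u we.
  rewrite -/A uA -scalemxAl mxE rVnormE pmulr_lge0 //.
  rewrite lt_def sumr_ge0 ?andbT; last by move=> i _; exact: sqr_ge0.
  apply: contraNneq u0 => /psumr_eq0P => s0; apply/eqP/rowP => i.
  by rewrite mxE; apply/eqP; rewrite -sqrf_eq0 s0 // => j _; exact: sqr_ge0.
have [Re0|] := eqVneq (map_mx (@complex.Re R) (row k P)) 0; last first.
  exact: pos (Re_eigenrow k).
have [Im0|] := eqVneq (map_mx (@complex.Im R) (row k P)) 0; last first.
  exact: pos (Im_eigenrow k).
have /negP[] := eigenrow_neq0 k; apply/eqP/rowP => j.
move/rowP/(_ j): Re0; move/rowP/(_ j): Im0; rewrite !mxE.
by case: (P k j) => a b /= -> ->.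
Qed.

Lemma eigenrow_const k : r 0 k = 0 -> forall i j, P k i = P k j.
Proof.
move=> rk0 i j.
have := laplacian_kernel econn we (p := map_mx (@complex.Re R) (row k P)).
rewrite -/A Re_eigenrow rk0 scale0r => /(_ erefl i j); rewrite !mxE.
have := laplacian_kernel econn we (p := map_mx (@complex.Im R) (row k P)).
rewrite -/A Im_eigenrow rk0 scale0r => /(_ erefl i j); rewrite !mxE.
by case: (P k i) => a b; case: (P k j) => c d /= -> ->.
Qed.

(** The all-ones vector is in the kernel; an index at which its coordinate [y] in the eigenbasis is
    nonzero has eigenvalue 0. *)
Lemma exists_eigenvalue0 : exists k, r 0 k = 0.
Proof.
pose one : 'rV[(R[i])%C]_n := map_mx toC (const_mx 1).
pose y := one *m P^t*.
have oneE : one = y *m P by rewrite /y mulmxKtV.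
have one0 : one != 0.
  apply/eqP => /rowP/(_ (Ordinal (ltnW n2))); rewrite !mxE => /eqP.
  by rewrite oner_eq0.
have yD : y *m diag_mx (map_mx toC r) = 0.
  have : one *m map_mx toC A = 0.
    by rewrite -map_mxM mulmx_const_laplacian // map_mx0.
  rewrite oneE -mulmxA PA mulmxA => /(congr1 (mulmx^~ (P^t*))).
  by rewrite mulmxtVK // mul0mx.
have [k yk] : exists k, y 0 k != 0.
  apply/existsP; apply: contraNT one0; rewrite negb_exists => /forallP y0.
  have yE : y = 0 by apply/rowP => k; rewrite [RHS]mxE; apply/eqP/negbNE/y0.
  by rewrite oneE yE mul0mx.
have /eqP : y 0 k * toC (r 0 k) = 0.
  by move/rowP/(_ k): yD; rewrite mul_mx_diag !mxE.
by rewrite mulf_eq0 (negbTE yk) /= => /eqP[rk]; exists k.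
Qed.

(** Eigenrows for 0 are constant and nonzero, and two such rows are never orthogonal, whereas
    distinct rows of [P] are. *)
Lemma eigenvalue0_uniq k l : r 0 k = 0 -> r 0 l = 0 -> k = l.
Proof.
move=> rk rl; apply/eqP; apply: contraT => kl.
have /unitarymxP/matrixP/(_ k l) := Pu; rewrite !mxE (negbTE kl).
pose i0 := Ordinal (ltnW n2).
under eq_bigr do rewrite !mxE (eigenrow_const rk _ i0) (eigenrow_const rl _ i0).
rewrite sumr_const card_ord => /eqP; rewrite mulrn_eq0 mulf_eq0 conjC_eq0.
have N0 m : r 0 m = 0 -> P m i0 == 0 = false.
  move=> rm; apply: contraNF (eigenrow_neq0 m) => /eqP P0.
  by apply/eqP/rowP => j; rewrite !mxE (eigenrow_const rm _ i0).
by rewrite !N0 // !orbF; case: (n) n2.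
Qed.

(** In the coordinates [y] of [p], the form is the sum of [r 0 k] times the squared modulus of
    [y 0 k], and the norm is the same sum without eigenvalues. The coordinate at [k0] drops out
    because [p] is orthogonal to constants. *)
Lemma poincare_eigenbasis k0 s1 : r 0 k0 = 0 ->
  (forall k, k != k0 -> s1 <= r 0 k) ->
  forall p : 'rV[R]_n, \sum_i p 0 i = 0 ->
    s1 * \sum_i p 0 i ^+ 2 <= (p *m A *m p^T) 0 0.
Proof.
move=> rk0 s1r p p0; pose p' := map_mx toC p; pose y := p' *m P^t*.
have p'E : p' = y *m P by rewrite /y mulmxKtV.
have p'T : map_mx toC p^T = P^t* *m y^t*.
  rewrite -map_mxM -trmx_mul -p'E /p'; apply/matrixP => i j; rewrite !mxE.
  by apply/esym/conj_Creal/complex_realP; exists (p j i).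
have yk0 : y 0 k0 = 0.
  pose i0 := Ordinal (ltnW n2).
  rewrite mxE; under eq_bigr do rewrite !mxE (eigenrow_const rk0 _ i0).
  by rewrite -mulr_suml -rmorph_sum /= p0 mul0r.
clearbody y.
have formC : toC ((p *m A *m p^T) 0 0) =
    \sum_k toC (r 0 k) * (y 0 k * (y 0 k)^*).
  have -> : toC ((p *m A *m p^T) 0 0) = (map_mx toC (p *m A *m p^T)) 0 0.
    by rewrite [RHS]mxE.
  rewrite !map_mxM -/p' p'T p'E -(mulmxA y) PA !mulmxA mulmxtVK //.
  rewrite mxE; apply: eq_bigr => k _.
  by rewrite mul_mx_diag !mxE mulrA [y 0 k * _]mulrC.
have normC : toC (\sum_i p 0 i ^+ 2) = \sum_k y 0 k * (y 0 k)^*.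
  have -> : toC (\sum_i p 0 i ^+ 2) = (map_mx toC (p *m p^T)) 0 0.
    by rewrite [RHS]mxE rVnormE.
  rewrite !map_mxM -/p' p'T p'E !mulmxA mulmxtVK //.
  by rewrite mxE; apply: eq_bigr => k _; rewrite !mxE.
rewrite -lecR rmorphM /= normC formC mulr_sumr; apply: ler_sum => k _.
have [->|/s1r s1k] := eqVneq k k0; first by rewrite yk0 mul0r !mulr0.
by apply: ler_wpM2r; [exact: mul_conjC_ge0 | rewrite lecR].
Qed.

End Eigenbasis.

Lemma laplacian_second_eigenvalue s : sorted <=%R s ->
  char_poly A = \prod_(x <- s) ('X - x%:P) ->
  0 < s`_1 /\ forall p : 'rV[R]_n, \sum_i p 0 i = 0 ->
    s`_1 * \sum_i p 0 i ^+ 2 <= (p *m A *m p^T) 0 0.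
Proof.
move=> s_sorted sA.
have [P [r [Pu PA charA]]] := symmetric_unitary_diag (weighted_laplacian_tr wT).
have [k0 rk0] := exists_eigenvalue0 Pu PA.
(* The index [k0] is removed rather than the value 0, so multiplicities are kept. *)
pose t := sort <=%R [seq r 0 k | k <- enum 'I_n & k != k0].
have tP x : reflect (exists2 k, k != k0 & x = r 0 k) (x \in t).
  rewrite mem_sort; apply: (iffP mapP) => [[k]|[k kk0 ->]].
    by rewrite mem_filter => /andP[kk0 _] ->; exists k.
  by exists k; rewrite // mem_filter kk0 mem_enum.
have s_perm : perm_eq s (0 :: t).
  apply: (@perm_trans _ [seq r 0 k | k <- enum 'I_n]).
    by apply: prod_XsubC_eq; rewrite -sA charA big_map big_enum.
  apply: (@perm_trans _ (0 :: [seq r 0 k | k <- enum 'I_n & k != k0])).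
    rewrite -rk0 -map_cons; apply: perm_map.
    by rewrite -rem_filter ?enum_uniq // perm_to_rem // mem_enum.
  by rewrite perm_cons perm_sym perm_sort.
(* Both lists are sorted, 0 coming first because eigenvalues are nonnegative, so being permutations
   of each other they coincide. *)
have sE : s = 0 :: t.
  apply: (sorted_eq le_trans le_anti) => //.
  rewrite /= path_min_sorted ?sort_le_sorted //.
  by apply/allP => x /tP[k _ ->]; exact: eigenvalue_ge0 Pu PA k.
have t0 : (0 < size t)%N.
  rewrite size_sort size_map -rem_filter ?enum_uniq // size_rem ?mem_enum //.
  by rewrite size_enum_ord -ltnS prednK // ltnW.
have [k1 k10 s1E] := tP _ (mem_nth 0 t0).
have s1r k : k != k0 -> t`_0 <= r 0 k.
  move=> kk0; have : r 0 k \in t by apply/tP; exists k.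
  have : sorted <=%R t by exact: sort_le_sorted.
  case: (t) => //= x t' /(order_path_min le_trans)/allP xt.
  by rewrite inE => /predU1P[->//|/xt].
rewrite sE /=; split; last exact: (poincare_eigenbasis Pu PA rk0 s1r).
rewrite s1E lt_def (eigenvalue_ge0 Pu PA) andbT.
apply: contraNneq k10 => rk1; apply/eqP.
exact: (eigenvalue0_uniq Pu PA rk1 rk0).
Qed.

(** The sorted diagonal entries [r] are a witness, which rules out the default value of [xget]. *)
Lemma laplacian_eigenvalues :
  sorted <=%R (eigenvalues A) /\
  char_poly A = \prod_(x <- eigenvalues A) ('X - x%:P).
Proof.
have [P [r [_ _ charA]]] := symmetric_unitary_diag (weighted_laplacian_tr wT).
rewrite /eigenvalues; case: xgetP => [s _ []//|].
move/(_ (sort <=%R [seq r 0 k | k <- enum 'I_n]))=> [].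
split; first exact: sort_le_sorted.
rewrite -/A charA (perm_big [seq r 0 k | k <- enum 'I_n]) ?perm_sort //=.
by rewrite big_map big_enum.
Qed.

End SpectralGap.

(** * Comparison of the metric with the graph Laplacian *)

Section MetricBound.
Variables (R : realType) (N : nat) (e : rel 'I_N).
Hypothesis esym : symmetric e.
Hypothesis econn : forall i j : 'I_N, connect e i j.

Lemma adjacency_weights : weights_on e (adjacency e R).
Proof.
split=> [|i j|i j eij]; last by rewrite mxE eij.
  by apply/matrixP => i j; rewrite !mxE esym.
by rewrite mxE.
Qed.

Lemma graph_laplacianE :
  graph_laplacian e R = weighted_laplacian (adjacency e R).
Proof.
rewrite /graph_laplacian /weighted_laplacian; congr (diag_mx _ - _).
apply/rowP => i; rewrite !mxE /degree cardsE -sum1_card natr_sum big_mkcond.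
by apply: eq_bigr => j _; rewrite !mxE unfold_in; case: ifP.
Qed.

Lemma spectral_gap_poincare : (2 <= N)%N ->
  0 < spectral_gap R e /\ forall p : 'rV[R]_N, \sum_i p 0 i = 0 ->
    spectral_gap R e * \sum_i p 0 i ^+ 2 <=
    (p *m weighted_laplacian (adjacency e R) *m p^T) 0 0.
Proof.
move=> N2; rewrite /spectral_gap graph_laplacianE.
have [sorted_s sE] := laplacian_eigenvalues adjacency_weights.
exact: laplacian_second_eigenvalue N2 econn adjacency_weights _ sorted_s sE.
Qed.

Lemma wm_weights (rho : 'rV[R]_N) : (forall i, 0 < rho 0 i) ->
  weights_on e (wm e rho).
Proof.
move=> rho0; split=> [|i j|i j eij].
- by apply/matrixP => i j; rewrite !mxE esym maxC.
- by rewrite mxE; case: ifP => // _; rewrite le_max ltW.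
- by rewrite mxE eij lt_max rho0.
Qed.

(* With [sigma = p *m Lm rho], both [gm rho sigma sigma] and the pairing of p
   with sigma are invariant under shifting p by a constant, so the Poincare
   inequality applies to the centred p. *)
Lemma gm_le (c lam : R) (rho sigma : 'rV[R]_N) : 0 < c -> 0 < lam ->
  (forall p : 'rV[R]_N, \sum_i p 0 i = 0 ->
    lam * \sum_i p 0 i ^+ 2 <=
    (p *m weighted_laplacian (adjacency e R) *m p^T) 0 0) ->
  (forall i, c <= rho 0 i) -> \sum_i sigma 0 i = 0 ->
  gm e rho sigma sigma <= (\sum_i sigma 0 i ^+ 2) / (c * lam).
Proof.
move=> c0 lam0 poincare c_rho sigma0.
have rho0 i : 0 < rho 0 i by exact: lt_le_trans (c_rho i).
have we := wm_weights rho0; have [wT _ _] := we.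
have [aT _ _] := adjacency_weights.
have /submxP[q sq] := laplacian_image econn we sigma0.
(* The centring below divides by [N]; on an empty vertex set the form is an empty sum. *)
case: (posnP N) => [N0|Npos].
  rewrite sq gmE // mxE big1 => [|i]; last by have := ltn_ord i; rewrite {2}N0.
  by rewrite divr_ge0 ?sumr_ge0 // => [i _|]; rewrite ?sqr_ge0 // mulr_ge0 ?ltW.
pose a := (\sum_i q 0 i) / N%:R; pose p := q - const_mx a.
have N0 : N%:R != 0 :> R by rewrite pnatr_eq0 -lt0n.
have p0 : \sum_i p 0 i = 0.
  under eq_bigr do rewrite !mxE; rewrite big_split /= sumr_const card_ord.
  by rewrite -mulr_natr mulNr divfK // subrr.
have sp : sigma = p *m Lm e rho.
  by rewrite mulmxBl mulmx_const_laplacian // subr0.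
have gE : gm e rho sigma sigma = (p *m Lm e rho *m p^T) 0 0.
  by rewrite {1 2}sp gmE.
have gE' : gm e rho sigma sigma = \sum_i sigma 0 i * p 0 i.
  by rewrite gE -sp mxE; apply: eq_bigr => i _; rewrite mxE.
have g_ge : c * lam * \sum_i p 0 i ^+ 2 <= gm e rho sigma sigma.
  rewrite gE -mulrA; apply: (@le_trans _ _
    ((p *m weighted_laplacian (c *: adjacency e R) *m p^T) 0 0)).
    rewrite weighted_laplacianZ -scalemxAr -scalemxAl mxE ler_pM2l //.
    exact: poincare.
  apply: le_dirichlet_form => // [|i j]; first by rewrite linearZ /= aT.
  rewrite !mxE; case: (e i j); rewrite ?mulr0 // mulr1.
  by rewrite le_max c_rho.
set g := gm e rho sigma sigma in gE' g_ge *; pose k := c * lam.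
have k0 : 0 < k by exact: mulr_gt0.
(* Young's inequality for the pairing of [sigma] with [p]. By [g_ge] the last term is at most
   [g / 2] and is absorbed on the left. *)
have : g <= (\sum_i sigma 0 i ^+ 2) / (2 * k) + (k * \sum_i p 0 i ^+ 2) / 2.
  rewrite gE' mulr_sumr !mulr_suml -big_split; apply: ler_sum => i _ /=.
  set x := sigma 0 i; set y := p 0 i; rewrite -subr_ge0.
  have -> : x ^+ 2 / (2 * k) + k * y ^+ 2 / 2 - x * y =
            (x - k * y) ^+ 2 / (2 * k) by field; rewrite gt_eqF.
  by rewrite divr_ge0 ?sqr_ge0 // mulr_ge0 // ltW.
move: g_ge; rewrite -/k invfM; lra.
Qed.

End MetricBound.

(** * Entropy *)

Section Entropy.
Variable R : realType.

(* [ln (x / y) = - 2 ln (sqrt y / sqrt x) >= 2 (1 - sqrt y / sqrt x)] bounds the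
   right-hand side below by [(sqrt x - sqrt y) ^+ 2]. *)
Lemma entropy_term_ge (x y t : R) : 0 < x -> 0 < y ->
  2 * t * `|x - y| - 2 * t ^+ 2 * (x + y) <= x * ln (x / y) - x + y.
Proof.
move=> x0 y0; pose a := Num.sqrt x; pose b := Num.sqrt y.
have a0 : 0 < a by rewrite sqrtr_gt0.
have b0 : 0 < b by rewrite sqrtr_gt0.
have xE : x = a ^+ 2 by rewrite sqr_sqrtr // ltW.
have yE : y = b ^+ 2 by rewrite sqr_sqrtr // ltW.
clearbody a b; subst x y.
apply: (@le_trans _ _ ((a - b) ^+ 2)).
  have -> : `|a ^+ 2 - b ^+ 2| = `|a - b| * (a + b).
    by rewrite subr_sqr normrM (gtr0_norm (addr_gt0 a0 b0)).
  rewrite -(real_normK (num_real (a - b))); set d := `|a - b|.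
  have dE : d ^+ 2 = (a - b) ^+ 2 by rewrite real_normK ?num_real.
  (* This square bounds [2 * t * d * (a + b)]; the next one replaces [(a + b) ^+ 2] by
     [2 * (a ^+ 2 + b ^+ 2)]. *)
  have := sqr_ge0 (d - t * (a + b)).
  have : 0 <= (t * (a - b)) ^+ 2 by exact: sqr_ge0.
  lra.
have lnE : ln (a ^+ 2 / b ^+ 2) = - (ln (b / a) *+ 2).
  rewrite -lnXn ?divr_gt0 // -lnV ?posrE ?exprn_gt0 ?divr_gt0 //.
  by rewrite -expr_div_n -exprVn invf_div.
have : ln (b / a) <= b / a - 1.
  by rewrite -{1}(subrK 1 (b / a)) addrC le_ln1Dx // ltrBDl subrr divr_gt0.
rewrite lnE -subr_ge0 => h; rewrite -subr_ge0.
have := mulr_ge0 (ltW (exprn_gt0 2 a0)) h.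
have -> : a ^+ 2 * (b / a - 1 - ln (b / a)) =
  a * b - a ^+ 2 - a ^+ 2 * ln (b / a) by field; rewrite gt_eqF.
rewrite mulrN mulrnAr; lra.
Qed.

(** Each [s i] is minus the sum of the others, so its absolute value is at most half the total;
    multiplying by [|s i|] and summing gives the bound. *)
Lemma sumsq_le_sumabs n (s : 'I_n -> R) : \sum_i s i = 0 ->
  \sum_i s i ^+ 2 <= (\sum_i `|s i|) ^+ 2 / 2.
Proof.
move=> s0; have half i : `|s i| <= (\sum_j `|s j|) / 2.
  have sE : s i = - \sum_(j | j != i) s j.
    by apply/eqP; rewrite -addr_eq0 -[X in _ == X]s0 [X in _ == X](bigD1 i).
  have := ler_norm_sum (index_enum _) s (fun j => j != i).
  rewrite -normrN -sE [X in _ -> _ <= X / 2](bigD1 i) //=; lra.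
rewrite expr2 -mulrA mulr_suml; apply: ler_sum => i _.
by rewrite -real_normK ?num_real // expr2 ler_wpM2l.
Qed.

Lemma relative_entropy_ge n (nu mu : 'rV[R]_n) :
  prob_simplex nu -> prob_simplex mu ->
  (\sum_i (mu - nu) 0 i ^+ 2) <= 2 * relative_entropy nu mu.
Proof.
move=> [nu1 nu0] [mu1 mu0]; pose S := \sum_i `|nu 0 i - mu 0 i|.
have ent : S ^+ 2 / 4 <= relative_entropy nu mu.
  (* The free parameter of [entropy_term_ge] is set to [S / 4], which maximises
     [2 * t * S - 4 * t ^+ 2]. *)
  have -> : S ^+ 2 / 4 = 2 * (S / 4) * (\sum_i `|nu 0 i - mu 0 i|) -
      2 * (S / 4) ^+ 2 * (\sum_i nu 0 i + \sum_i mu 0 i).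
    by rewrite -/S nu1 mu1; field.
  have -> : relative_entropy nu mu =
      \sum_i (nu 0 i * ln (nu 0 i / mu 0 i) - nu 0 i + mu 0 i).
    by rewrite !big_split /= sumrN nu1 mu1 addrNK.
  rewrite -big_split !mulr_sumr -sumrB.
  by apply: ler_sum => i _; exact: entropy_term_ge.
have : \sum_i (mu - nu) 0 i ^+ 2 <= S ^+ 2 / 2.
  have -> : \sum_i (mu - nu) 0 i ^+ 2 = \sum_i (nu 0 i - mu 0 i) ^+ 2.
    by apply: eq_bigr => i _; rewrite !mxE -sqrrN opprB.
  by apply: sumsq_le_sumabs; rewrite sumrB nu1 mu1 subrr.
lra.
Qed.

(** Since 64 is the sixth power of 2, it suffices that [ln 2] is at least 1/2, which is
    [ln (1 + x) <= x] at [x = - 1/2]. *)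
Lemma ln_ge3 (x : R) : 64 <= x -> 3 <= ln x.
Proof.
move=> x64; have : 3 <= ln (64 : R).
  have -> : (64 : R) = 2 ^+ 6 by rewrite -natrX.
  rewrite lnXn // -[2]invrK lnV ?posrE ?invr_gt0 //.
  have : ln (2^-1 : R) <= - 2^-1.
    by rewrite {1}(_ : 2^-1 = 1 + - 2^-1) ?le_ln1Dx //; [lra | field].
  by rewrite -mulr_natr; lra.
by move/le_trans; apply; rewrite ler_ln ?posrE //; exact: lt_le_trans x64.
Qed.

End Entropy.

(** * The curve *)

(** The integral of a nonnegative function is a supremum over the simple functions below it, hence
    monotone. The argument covers arbitrary functions, such as the speed in [length_m]. *)
Lemma integral_le_cst (R : realType) (D : set R) (f : R -> \bar R) (c : R) :
  measurable D -> (forall x, D x -> (0 <= f x <= c%:E)%E) ->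
  (\int[@lebesgue_measure R]_(x in D) f x <= c%:E * lebesgue_measure D)%E.
Proof.
move=> mD fc; rewrite -integral_cst //.
rewrite !ge0_integralE; last 2 first.
- by move=> x /fc/andP[].
- by move=> x /fc/andP[]; exact: le_trans.
apply: ereal_sup_le => _ [h hf <-]; exists h => // x.
by apply: le_trans (hf x) _; apply: lee_restrict => y /fc/andP[].
Qed.

Section Curve.
Variables (R : realType) (N : nat).
Implicit Types (nu mu : 'rV[R]_N).

(** Every point of the interval, endpoints included, is an accumulation point of it; this makes
    limits unique, so that [velocity] can be computed. *)
Lemma within01_dnbhs_proper (t : R) : 0 <= t <= 1 ->
  ProperFilter (within `[0, 1] (t^')).
Proof.
move=> /andP[t0 t1]; split; last exact: within_filter.
rewrite /within /= => -[r /= r0 rt].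
(* A step of length at most 1/2 away from the nearer endpoint stays in the interval. *)
pose d := Num.min r 1 / 2.
have d0 : 0 < d by rewrite divr_gt0 // lt_min r0 ltr01.
have dr : d < r by rewrite ltr_pdivrMr // gt_min mulr_natr mulr2n ltrDl r0.
have d1 : d <= 1 / 2 by rewrite ler_pM2r ?invr_gt0 // ge_min lexx orbT.
have [t12|t12] := leP t (1 / 2).
- apply: (rt (t + d)).
  + by rewrite /ball /= opprD addrA subrr sub0r normrN gtr0_norm.
  + by rewrite gt_eqF // ltrDl.
  + by rewrite /= in_itv /=; apply/andP; split; lra.
- apply: (rt (t - d)).
  + by rewrite /ball /= opprB addrC subrK gtr0_norm.
  + by rewrite lt_eqF // ltrBlDr ltrDl.
  + by rewrite /= in_itv /=; apply/andP; split; lra.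
Qed.

Definition quadratic_segment nu mu (s : R) : 'rV[R]_N :=
  nu + s ^+ 2 *: (mu - nu).

Lemma quadratic_segment_quotient nu mu t : 0 <= t <= 1 ->
  diff_quotient (quadratic_segment nu mu) t s @[s --> within `[0, 1] (t^')]
    --> (2 * t) *: (mu - nu).
Proof.
move=> t01; have F := @within01_dnbhs_proper t t01.
have -> : 2 * t = t + t by rewrite mulr_natl mulr2n.
apply: (@cvg_trans _ ((s + t) *: (mu - nu) @[s --> within `[0, 1] (t^')])).
  apply: near_eq_cvg.
  rewrite near_withinE; apply: filterS (nbhs_dnbhs_neq t) => s st _.
  rewrite /diff_quotient /quadratic_segment opprD addrACA subrr add0r.
  rewrite -scalerBl scalerA subr_sqr mulrA mulVf ?mul1r //.
  by rewrite subr_eq0.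
apply: cvg_within_filter; apply: cvgZr_tmp; apply: cvgD; last exact: cvg_cst.
by apply: cvg_within.
Qed.

Lemma velocity_quadratic_segment nu mu t : 0 <= t <= 1 ->
  velocity (quadratic_segment nu mu) t = (2 * t) *: (mu - nu).
Proof.
move=> t01; have F := @within01_dnbhs_proper t t01.
by apply: cvg_lim; [exact: norm_hausdorff | exact: quadratic_segment_quotient].
Qed.

Lemma quadratic_segment_admissible nu mu :
  prob_simplex nu -> prob_simplex mu ->
  admissible_curve nu mu (quadratic_segment nu mu).
Proof.
move=> [nu1 nu0] [mu1 mu0]; split.
- split=> [t t01|].
    apply/cvg_ex; exists ((2 * t) *: (mu - nu)).
    exact: quadratic_segment_quotient.
  apply: (@subspace_eq_continuous _ _ _ (fun t : R => (2 * t) *: (mu - nu))).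
    move=> t; rewrite inE /= in_itv /= => t01.
    exact/esym/velocity_quadratic_segment.
  apply: continuous_subspaceT => t; apply: cvgZr_tmp.
  by apply: cvgM; [exact: cvg_cst | exact: cvg_id].
- move=> t /andP[t0 t1]; have t2 : 0 <= t ^+ 2 <= 1.
    by rewrite sqr_ge0 expr_le1.
  split=> [|i]; last first.
    rewrite !mxE; move: (nu0 i) (mu0 i); set x := nu 0 i; set y := mu 0 i.
    by move: t2; set u := t ^+ 2 => /andP[u0 u1] x0 y0; nra.
  under eq_bigr do rewrite !mxE.
  by rewrite big_split /= nu1 -mulr_sumr sumrB mu1 nu1 subrr mulr0 addr0.
- by rewrite /quadratic_segment expr0n scale0r addr0.
- by rewrite /quadratic_segment expr1n scale1r addrC subrK.
Qed.

End Curve.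

(** * Distance bound *)

Section DistanceBound.
Variables (R : realType) (N : nat) (e : rel 'I_N).
Hypothesis N2 : (2 <= N)%N.
Hypothesis esym : symmetric e.
Hypothesis econn : forall i j : 'I_N, connect e i j.
Variables (nu mu : 'rV[R]_N).
Hypothesis hnu : prob_simplex nu.
Hypothesis hmu : prob_simplex mu.

Lemma min_entry_gt0 : 0 < min_entry mu.
Proof.
by rewrite /min_entry; case: hmu => _ mu0; apply: lt_bigmin.
Qed.

Lemma gm_quadratic_segment t : 0 <= t <= 1 ->
  let v := velocity (quadratic_segment nu mu) t in
  gm e (quadratic_segment nu mu t) v v <=
  4 * (\sum_i (mu - nu) 0 i ^+ 2) / (min_entry mu * spectral_gap R e).
Proof.
move=> t01 /=; rewrite velocity_quadratic_segment //.
have [lam0 poincare] := spectral_gap_poincare R esym econn N2.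
have m0 := min_entry_gt0; have [nu1 nu0] := hnu; have [mu1 mu0] := hmu.
set S := \sum_i _; have S0 : 0 <= S by apply: sumr_ge0 => i _; exact: sqr_ge0.
(* At [t = 0] the entrywise bound [t ^+ 2 * min_entry mu] degenerates and [gm_le] does not apply,
   but the velocity vanishes. *)
have [->|t_neq0] := eqVneq t 0.
  rewrite mulr0 scale0r /gm !mul0mx mxE.
  by rewrite divr_ge0 ?mulr_ge0 // ltW // mulr_gt0.
have t2 : 0 < t ^+ 2 by rewrite exprn_gt0 // lt_def t_neq0; case/andP: t01.
have t21 : t ^+ 2 <= 1 by case/andP: t01 => t0 t1; rewrite expr_le1.
apply: (@le_trans _ _ ((\sum_i ((2 * t) *: (mu - nu)) 0 i ^+ 2) /
                       ((t ^+ 2 * min_entry mu) * spectral_gap R e))).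
  apply: gm_le => //; first exact: mulr_gt0.
    move=> i; have mi : min_entry mu <= mu 0 i by exact: bigmin_le.
    rewrite !mxE; apply: (@le_trans _ _ (t ^+ 2 * mu 0 i)).
      by rewrite ler_pM2l.
    have := mulr_ge0 (ltW (nu0 i)) (_ : 0 <= 1 - t ^+ 2); rewrite subr_ge0.
    move=> /(_ t21); lra.
  under eq_bigr do rewrite !mxE.
  by rewrite -mulr_sumr sumrB mu1 nu1 subrr mulr0.
(* The factor [t ^+ 2] of the squared velocity cancels the one in the bound on the entries, which is
   the purpose of the quadratic parametrization. *)
have -> : \sum_i ((2 * t) *: (mu - nu)) 0 i ^+ 2 = t ^+ 2 * (4 * S).
  by rewrite !mulr_sumr; apply: eq_bigr => i _; rewrite [_ 0 i]mxE; ring.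
suff -> : t ^+ 2 * (4 * S) / (t ^+ 2 * min_entry mu * spectral_gap R e) =
  4 * S / (min_entry mu * spectral_gap R e) by [].
by field; rewrite t_neq0 !gt_eqF.
Qed.

Lemma dm_sqr_le :
  (dm e nu mu ^+ 2 <=
   (8 * relative_entropy nu mu / (min_entry mu * spectral_gap R e))%:E)%E.
Proof.
have [lam0 _] := spectral_gap_poincare R esym econn N2.
have ml0 := mulr_gt0 min_entry_gt0 lam0.
set k := _ * spectral_gap R e in ml0 *; pose S := \sum_i (mu - nu) 0 i ^+ 2.
have S0 : 0 <= S by apply: sumr_ge0 => i _; exact: sqr_ge0.
pose c := Num.sqrt (4 * S / k).
(* Nonnegativity allows the bound on [dm] to be squared. *)
have dm0 : (0 <= dm e nu mu)%E.
  apply: le_ereal_inf_tmp => _ [gamma _ <-]; apply: integral_ge0 => t _.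
  by rewrite lee_fin sqrtr_ge0.
have dmc : (dm e nu mu <= c%:E)%E.
  apply: ge_ereal_inf; exists (length_m e (quadratic_segment nu mu)).
    exists (quadratic_segment nu mu) => //.
    exact: quadratic_segment_admissible.
  apply: le_trans (integral_le_cst (c := c) _ _) _ => //.
    move=> t; rewrite /= in_itv /= => t01.
    by rewrite !lee_fin sqrtr_ge0 ler_wsqrtr //; exact: gm_quadratic_segment.
  by rewrite lebesgue_measure_itv /= lte_fin ltr01 oppr0 adde0 mule1.
apply: (@le_trans _ _ (c%:E ^+ 2)%E).
  by rewrite lee_sqr // lee_fin sqrtr_ge0.
rewrite -EFin_expe lee_fin sqr_sqrtr; last first.
  by apply: divr_ge0; [exact: mulr_ge0 | exact: ltW].
rewrite ler_pM2r ?invr_gt0 //.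
have := relative_entropy_ge hnu hmu; rewrite -/S; lra.
Qed.

(** * Numerical estimates for the constant [K] *)

Lemma max_entry_ge : 1 <= N%:R * max_entry mu.
Proof.
have [mu1 _] := hmu; rewrite -[leLHS]mu1 mulr_natl.
rewrite -[X in _ *+ X]card_ord -sumr_const.
by apply: ler_sum => i _; exact: le_bigmax.
Qed.

Lemma min_entry_le : N%:R * min_entry mu <= 1.
Proof.
have [mu1 _] := hmu; rewrite -[leRHS]mu1 mulr_natl.
rewrite -[X in _ *+ X]card_ord -sumr_const.
by apply: ler_sum => i _; exact: bigmin_le.
Qed.

Lemma min_entry_le_max : min_entry mu <= max_entry mu.
Proof.
pose i0 := Ordinal (ltnW N2).
by apply: (@le_trans _ _ (mu 0 i0)); [exact: bigmin_le | exact: le_bigmax].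
Qed.

Lemma max_degree_ge1 : (1 <= max_degree e)%N.
Proof.
pose i0 := Ordinal (ltnW N2); pose i1 := Ordinal N2.
have /connectP[[|j s] /=] := econn i0 i1; first by move=> _ /(congr1 val).
move=> /andP[eij _] _; apply: (@leq_trans (degree e i0)).
  by rewrite card_gt0; apply/set0Pn; exists j; rewrite inE.
exact: leq_bigmax.
Qed.

(** The logarithm is at least 3 and so is the factor before it, and 9 exceeds 8. *)
Lemma constant_ge8 :
  8 <= max_entry mu * ((max_degree e)%:R * N%:R ^+ 3 + 4) / 2 *
       ln (18 * max_entry mu / min_entry mu ^+ 3).
Proof.
have m0 := min_entry_gt0; have NM := max_entry_ge; have Nm := min_entry_le.
have mM := min_entry_le_max.
move: m0 NM Nm mM; set m := min_entry mu; set M := max_entry mu => m0 NM Nm mM.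
have N2' : 2 <= N%:R :> R by rewrite ler_nat.
have D1 : 1 <= (max_degree e)%:R :> R by rewrite ler1n max_degree_ge1.
move: N2' D1 NM Nm; set n := N%:R; set D := (max_degree e)%:R => N2' D1 NM Nm.
have M0 : 0 < M by exact: lt_le_trans mM.
have ln3 : 3 <= ln (18 * M / m ^+ 3).
  apply: ln_ge3; rewrite ler_pdivlMr ?exprn_gt0 //.
  (* From [m <= 1/2] follows [64 * m ^+ 3 <= 16 * m], which is at most [18 * M]. *)
  have m2 : m ^+ 2 <= 4^-1.
    have mn : 2 * m <= n * m by rewrite ler_pM2r.
    have -> : 4^-1 = 2^-1 * 2^-1 :> R by field.
    by apply: ler_pM; lra.
  have := ler_wpM2r (ltW m0) m2; rewrite -exprSr; lra.
have n3 : 6 * n <= n ^+ 3 + 4.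
  have -> : n ^+ 3 + 4 = 6 * n + (n - 2) * (n ^+ 2 + 2 * n - 2) by ring.
  rewrite lerDl; apply: mulr_ge0; first by rewrite subr_ge0.
  by have := sqr_ge0 n; lra.
have M6 : 6 <= M * (D * n ^+ 3 + 4).
  have Dn : n ^+ 3 <= D * n ^+ 3 by rewrite ler_peMl // exprn_ge0 //; lra.
  have : M * (6 * n) <= M * (D * n ^+ 3 + 4) by rewrite ler_pM2l //; lra.
  lra.
nra.
Qed.

End DistanceBound.

Theorem theorem4p3 (R : realType) (N : nat) (hN : (2 <= N)%N)
    (e : rel 'I_N) (esym : symmetric e) (eirr : irreflexive e)
    (econn : forall i j : 'I_N, connect e i j)
    (mu : 'rV[R]_N) (hmu : prob_simplex mu) :
  let D := (max_degree e)%:R : R in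
  let lambda2 := spectral_gap R e in
  let m := min_entry mu in
  let M := max_entry mu in
  let K := M * (D * N%:R ^+ 3 + 4) / (2 * lambda2 * m)
           * ln (18 * M / m ^+ 3) in
  forall nu : 'rV[R]_N, prob_simplex nu ->
    (dm e nu mu ^+ 2 <= (K * relative_entropy nu mu)%:E)%E.
Proof.
move=> D lambda2 m M K nu hnu.
have [lam0 _] := spectral_gap_poincare R esym econn hN.
have m0 : 0 < m := min_entry_gt0 hmu.
(* The sign of the entropy lets it be cancelled, leaving a comparison of constants. *)
have H0 : 0 <= relative_entropy nu mu.
  have := relative_entropy_ge hnu hmu.
  have : 0 <= \sum_i (mu - nu) 0 i ^+ 2.
    by apply: sumr_ge0 => i _; exact: sqr_ge0.
  lra.
apply: le_trans (dm_sqr_le hN esym econn hnu hmu) _; rewrite lee_fin.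
rewrite mulrAC ler_wpM2r // ler_pdivrMr ?mulr_gt0 //.
apply: le_trans (constant_ge8 hN econn hmu) _.
rewrite le_eqVlt; apply/orP; left.
by apply/eqP; rewrite /K -/m -/M -/lambda2 -/D; field; rewrite !gt_eqF.
Qed.
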